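(* Let $X\subset\mathbb{R}^d$, $\Delta$, $\mathbb{P}$ and the sets $X_\delta$ ($\delta\in\Delta$) satisfy assumptions (1)–(3) listed in the context, and consider any algorithm $A_N$ and any support subsample function $B_N$ as defined in the context. Fix $\beta\in(0,1)$ and define the violation level $\epsilon:\{0,\dots,N\}\to[0,1]$ as a function such that $$\epsilon(N)=1\quad\text{and}\quad \sum_{k=0}^{N-1}\binom{N}{k}(1-\epsilon(k))^{N-k}=\beta .$$ Then $$\mathbb{P}^N\Big\{\{\delta_i\}_{i=1}^N\in\Delta^N:\ \mathbb{V}(\Pi_N)>\epsilon(F_N)\Big\}\le\beta,$$ where $\mathbb{P}^N=\prod_{i=1}^N\mathbb{P}$ is the product probability measure and $F_N$ is the number of facets of $\Pi_N$.
   Context: Setting. $(\Delta,\mathcal{F},\mathbb{P})$ is a (possibly unknown) probability space; its elements are vectors $\delta=(a^T\ b)\in\mathbb{R}^{d+1}$ with $a\in\mathbb{R}^d$, $b\in\mathbb{R}$. $N$ is the number of samples and $\Delta^N$ is the $N$-fold cartesian product of $\Delta$. A multisample $\{\delta_i\}_{i=1}^N\in\Delta^N$ consists of $N$ independent and identically distributed samples drawn from $\Delta$ according to $\mathbb{P}$. Assumptions. (1) $X\subset\mathbb{R}^d$ is a non-empty, compact and convex polytope. (2) For each $\delta=(a^T\ b)\in\Delta$, $X_\delta=\{x\in\mathbb{R}^d: g(x,\delta)\le 0\}$, where $g(x,\delta)=a^Tx-b$. (3) For each multisample $\{\delta_i\}_{i=1}^N$, the polytope $\Pi_N=\big(\bigcap_{i=1}^N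 X_{\delta_i}\big)\cap X=\{x\in X: g(x,\delta_i)\le 0,\ i=1,\dots,N\}$ has a non-empty interior. Probability of violation. For a point $x$, $V(x)=\mathbb{P}\{\delta\in\Delta: x\notin X_\delta\}$. Let $\mathcal{P}\subseteq 2^X$ be the set of all non-empty, compact and convex polytopes that are subsets of $X$. The probability of violation of a set is the mapping $\mathbb{V}:\mathcal{P}\to[0,1]$ given by $\mathbb{V}(\Pi_N)=\sup_{x\in\Pi_N}V(x)$ for any $\Pi_N\in\mathcal{P}$. Algorithm and support subsamples. For any $N$, an algorithm is a mapping $A_N:\Delta^N\to\mathcal{P}$ that associates the multisample $\{\delta_i\}_{i=1}^N$ to a unique polytope $\Pi_N\in\mathcal{P}$. Given a multisample $\{\delta_i\}_{i=1}^N\in\Delta^N$, a support subsample is a subset $\{\delta_i\}_{i\in I_k}$ of it, with $I_k=\{i_1,\dots,i_k\}$, $i_1<\dots<i_k$, $k\le N$, such that $A_k(\{\delta_i\}_{i\in I_k})=A_N(\{\delta_i\}_{i=1}^N)$; it is irreducible if no element can be further removed from it leaving the solution unchanged. A support subsample function $B_N$ takes as input all the samples $\{\delta_i\}_{i=1}^N$ and returns the indices $\{i_1,\dots,i_k\}$ of only those samples that constitute an irreducible support subsample. Facets. An affine inequality $a^Tx\le b$ is valid for a convex polytope $\Pi\subset\mathbb{R}^d$ if it is satisfied by all $x\in\Pi$. A face of $\Pi$ is any set $f=\Pi\cap\{x\in\mathbb{R}^d: a^Tx=b\}$ where $a^Tx\le b$ is a valid inequality for $\Pi$; it is a facet if $\dim(f)=\dim(\Pi)-1$.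 The number $F_N$ of facets of $\Pi_N$ is a random variable depending on the multisample.
   Formalization: Since ε is defined only on {0,…,N} while F_N may exceed N (facets inherited from X), ε(F_N) is read as ε(min(F_N,N)), i.e. 1 when F_N ≥ N; the algorithm A_N is taken to return the polytope Π_N of assumption (3), as the claim fails for arbitrary outputs. *)

(* Defs.v *)
From HB Require Import structures.
From mathcomp Require Import all_boot all_order all_algebra finmap.
From mathcomp Require Import all_classical all_reals all_analysis.
Import Order.TTheory GRing.Theory Num.Theory.
Import numFieldNormedType.Exports.

Set Implicit Arguments.
Unset Strict Implicit.
Unset Printing Implicit Defensive.

Local Open Scope classical_set_scope.
Local Open Scope ring_scope.

Section product_probability.
Context {disp : measure_display} {T : measurableType disp} {R : realType}.

Definition cons_tuple n (u : T * n.-tuple T) : n.+1.-tuple T :=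
  [the n.+1.-tuple T of u.1 :: u.2].

Lemma measurable_cons_tuple n : measurable_fun setT (@cons_tuple n).
Proof. exact: measurable_cons. Qed.

HB.instance Definition _ n :=
  isMeasurableFun.Build _ _ _ _ (@cons_tuple n) (@measurable_cons_tuple n).

(* The n-fold product P^n, on the product sigma-algebra of [n.-tuple T]. *)
Fixpoint prod_probability (P : probability T R) n :
    probability (n.-tuple T) R :=
  if n is m.+1 then distribution (P \x prod_probability P m)%E (@cons_tuple m)
  else \d_[tuple].

Lemma prod_probabilityE (P : probability T R) n (A : 'I_n -> set T) :
  (forall i, measurable (A i)) ->
  prod_probability P n [set s | forall i, A i (tnth s i)] =
  (\prod_(i < n) P (A i))%E.
Proof.
elim: n A => [|n IHn] A mA.
  by rewrite big_ord0 /= diracE mem_set// => -[].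
have mtail : measurable
    [set s : n.-tuple T | forall i, A (lift ord0 i) (tnth s i)].
  rewrite (_ : [set _ | _] = \bigcap_(i in [set: 'I_n])
      ((fun s : n.-tuple T => tnth s i) @^-1` A (lift ord0 i))).
    apply: fin_bigcap_measurable => // i _.
    by rewrite -[X in measurable X]setTI; exact: measurable_tnth.
  by apply/seteqP; split=> s As i; [move=> _|]; exact: As.
rewrite big_ord_recl /= /distribution /pushforward.
rewrite (_ : _ @^-1` _ = A ord0 `*`
  [set s | forall i, A (lift ord0 i) (tnth s i)]); last first.
  apply/seteqP; split => -[x s]/=.
    move=> As; split=> [|i]; first exact: (As ord0).
    by have := As (lift ord0 i); rewrite tnthS.
  by move=> [A0 As] i; have [j ->|->//] := unliftP ord0 i; rewrite tnthS.
rewrite product_measure1E//; congr (_ * _)%E; exact: IHn.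
Qed.

End product_probability.

Section polytopes.
Context {R : realType} {d : nat}.
Implicit Types (x : 'rV[R]_d) (S : set 'rV[R]_d).

Definition dot (u v : 'rV[R]_d) : R := (u *m v^T) 0 0.

(* A vector v = (a^T b) of R^(d+1) encodes the inequality a^T x <= b. *)
Definition g x (v : 'rV[R]_(d + 1)) : R := dot (lsubmx v) x - rsubmx v 0 0.

Definition halfspace (v : 'rV[R]_(d + 1)) : set 'rV[R]_d :=
  [set x | g x v <= 0].

Definition is_polytope S : Prop :=
  [/\ S !=set0, compact S, convex_set (S : set (convex_lmodType 'rV[R]_d)) &
      exists s : seq 'rV[R]_(d + 1),
        S = [set x | forall v, v \in s -> halfspace v x]].

Definition affinely_independent k (p : 'I_k -> 'rV[R]_d) : Prop :=
  forall l : 'I_k -> R,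
    \sum_(i < k) l i = 0 -> \sum_(i < k) l i *: p i = 0 -> forall i, l i = 0.

(* One less than the largest number of affinely independent points of S (at
   most d + 1 points of R^d are affinely independent); thus the empty set has
   dimension -1. *)
Definition affdim S : int :=
  (\max_(k < d.+2 | `[< exists p : 'I_k -> 'rV[R]_d,
      (forall i, S (p i)) /\ affinely_independent p >]) k)%:Z - 1.

Definition is_face S (f : set 'rV[R]_d) : Prop :=
  exists (a : 'rV[R]_d) (b : R),
    (forall x, S x -> dot a x <= b) /\ f = S `&` [set x | dot a x = b].

Definition is_facet S (f : set 'rV[R]_d) : Prop :=
  is_face S f /\ affdim f = affdim S - 1.

(* [fset_set] sends infinite sets to the empty one; a polytope has finitely
   many facets. *)
Definition num_facets S : nat :=
  #|` fset_set [set f | is_facet S f]|%fset.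

End polytopes.

Section scenario.
Context {R : realType} {d : nat}.
Context {disp : measure_display} {Delta : measurableType disp}.
Context (vec : Delta -> 'rV[R]_(d + 1)).
Implicit Types (X S : set 'rV[R]_d).

Definition feasible_set X n (s : n.-tuple Delta) : set 'rV[R]_d :=
  (\bigcap_(i in [set: 'I_n]) halfspace (vec (tnth s i))) `&` X.

Definition violation (P : probability Delta R) (x : 'rV[R]_d) : \bar R :=
  P [set delta | ~ halfspace (vec delta) x].

Definition set_violation (P : probability Delta R) S : \bar R :=
  ereal_sup [set violation P x | x in S].

Definition is_algorithm X N
    (A : forall n, n.-tuple Delta -> set 'rV[R]_d) : Prop :=
  forall n (s : n.-tuple Delta), (n <= N)%N ->
    [/\ is_polytope (A n s), A n s `<=` X & A n s = feasible_set X s].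

(* The samples with index in I, listed by increasing index. *)
Definition subsample N (s : N.-tuple Delta) (I : {set 'I_N}) :
    #|I|.-tuple Delta :=
  [tuple tnth s (enum_val j) | j < #|I|].

Definition support_subsample (A : forall n, n.-tuple Delta -> set 'rV[R]_d)
    N (s : N.-tuple Delta) (I : {set 'I_N}) : Prop :=
  A _ (subsample s I) = A N s.

Definition irreducible_support_subsample
    (A : forall n, n.-tuple Delta -> set 'rV[R]_d)
    N (s : N.-tuple Delta) (I : {set 'I_N}) : Prop :=
  support_subsample A s I /\
  forall i, i \in I -> ~ support_subsample A s (I :\ i).

Definition support_subsample_function
    (A : forall n, n.-tuple Delta -> set 'rV[R]_d)
    N (B : N.-tuple Delta -> {set 'I_N}) : Prop :=
  forall s, irreducible_support_subsample A s (B s).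

End scenario.

(* Main.v *)
(* Fix a set J of k < N samples. Conditionally on the samples in J, if the
   polytope they cut out of X contains a point of violation > eps k, then the
   other N - k samples all contain that point with probability at most
   (1 - eps k)^(N - k). Hence, by a union bound over J and k, it is enough that
   the polytope of the whole multisample, when it has k < N facets, is already
   cut out by some k of the samples. An irreducible support subsample has at
   most k elements: a sample i in it cuts off a point y_i that satisfies the
   other constraints, and the segment from an interior point z to y_i crosses
   the boundary of constraint i at a point interior to the other constraints,
   which yields distinct facets for distinct i. It can then be enlarged to k
   samples. *)
Require Import Defs.
From mathcomp Require Import all_boot all_order all_algebra.
From mathcomp Require Import ring lra.
From mathcomp Require Import all_classical all_reals all_analysis.
Import Order.TTheory GRing.Theory Num.Theory.
Import numFieldNormedType.Exports.
Local Open Scope classical_set_scope.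
Local Open Scope ring_scope.

(** * Enlarging a finite set to a prescribed size *)

Lemma exists_superset (T : finType) (I : {set T}) k :
  (#|I| <= k)%N -> (k <= #|T|)%N -> exists2 J : {set T}, I \subset J & #|J| = k.
Proof.
elim: k => [|k IHk]; first by rewrite leqn0 => /eqP I0; exists I.
rewrite leq_eqVlt => /orP[/eqP Ik _|]; first by exists I.
rewrite ltnS => Ik kT; have [J IJ Jk] := IHk Ik (ltnW kT).
have : (0 < #|~: J|%SET)%N by rewrite -subn_gt0 cardsCs finset.setCK Jk in kT *.
move=> /card_gt0P[x]; rewrite inE => xJ; exists (x |: J)%SET.
  exact: fintype.subset_trans IJ (finset.subsetUr _ _).
by rewrite cardsU1 xJ Jk.
Qed.

(** * Product measures: subadditivity, monotonicity, independence of coordinates *)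

Section product_probability.
Set Implicit Arguments.
Unset Strict Implicit.
Context {disp : measure_display} {T : measurableType disp} {R : realType}.
Local Open Scope ereal_scope.

(** Both conclusions share one induction, since subadditivity of two sets at each step uses that the
    remaining union is measurable. *)
Lemma measure_bigsetU_le (mu : {measure set T -> \bar R}) (I : Type)
    (r : seq I) (Q : pred I) (W : I -> set T) :
  (forall i, Q i -> measurable (W i)) ->
  measurable (\big[setU/set0]_(i <- r | Q i) W i) /\
  (mu (\big[setU/set0]_(i <- r | Q i) W i) <= \sum_(i <- r | Q i) mu (W i))%E.
Proof.
move=> mW; elim: r => [|i r [mr IHr]].
  by rewrite !big_nil measure0; split; [exact: measurable0|].
rewrite !big_cons; case: ifP => Qi //; split.
  by apply: measurableU => //; exact: mW.
by apply: (le_trans (measureU2 _ _ _)) => //; [exact: mW|exact: leeD2l].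
Qed.

(** The integral of a nonnegative function is a supremum over the simple functions below it, and
    this family grows with the function. *)
Lemma le_ge0_integral_nonmeasurable (mu : {measure set T -> \bar R})
    (f1 f2 : T -> \bar R) :
  (forall x, 0 <= f1 x) -> (forall x, f1 x <= f2 x) ->
  \int[mu]_x f1 x <= \int[mu]_x f2 x.
Proof.
move=> f10 f12; have f20 x : 0 <= f2 x by exact: le_trans (f12 x).
rewrite !ge0_integralTE//; apply: ereal_sup_le => _ [h hf <-].
by exists h => //= x; exact: le_trans (f12 x).
Qed.

(* Holds for all sets, as [prod_probability] is an iterated lower integral: the
   event bounded in [theorem6] need not be measurable. *)
Lemma prod_probability_mono (P : probability T R) n (A B : set (n.-tuple T)) :
  A `<=` B -> prod_probability P n A <= prod_probability P n B.
Proof.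
elim: n A B => [|n IHn] A B AB.
  rewrite /= !diracE lee_fin ler_nat.
  by case: (boolP (_ \in A)) => // /set_mem/AB/mem_set ->.
apply: le_ge0_integral_nonmeasurable => x; first exact: measure_ge0.
by apply: IHn => s; rewrite /xsection/= !inE => /AB.
Qed.

(** [M] depends only on the coordinates in [J], the other event only on those outside. The induction
    splits off the first coordinate and argues on sections. *)
Lemma prod_probability_indep (P : probability T R) n (J : pred 'I_n)
    (M : set (n.-tuple T)) (H : set T) :
  measurable M -> measurable H ->
  (forall s t : n.-tuple T, (forall i : 'I_n, J i -> tnth s i = tnth t i) ->
    M s -> M t) ->
  prod_probability P n
    (M `&` [set s | forall i : 'I_n, ~~ J i -> H (tnth s i)]) =
  prod_probability P n M * \prod_(i < n | ~~ J i) P H.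
Proof.
elim: n J M => [|n IHn] J M mM mH MJ.
  rewrite big_ord0 mule1 (_ : [set s | _] = setT) ?setIT//.
  by apply/seteqP; split => // s _ [].
pose tail (x : T) := [set s : n.-tuple T | M (Defs.cons_tuple (x, s))].
have mpre : measurable (@Defs.cons_tuple disp T n @^-1` M).
  by rewrite -[X in measurable X]setTI; exact: measurable_cons_tuple.
have tailE x : xsection (@Defs.cons_tuple disp T n @^-1` M) x = tail x.
  by apply/seteqP; split => s; rewrite /xsection/= inE.
have mtail (x : T) : measurable (tail x).
  by rewrite -tailE; exact: measurable_xsection.
have tailJ x (s t : n.-tuple T) :
    (forall i : 'I_n, J (lift ord0 i) -> tnth s i = tnth t i) -> tail x s -> tail x t.
  move=> st; apply: MJ => i; have [j ->|->//] := unliftP ord0 i.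
  by rewrite !tnthS; exact: st.
pose J' (i : 'I_n) := J (lift ord0 i).
rewrite big_mkcond big_ord_recl /= -(big_mkcond (fun i : 'I_n => ~~ J' i)).
rewrite /= /distribution /pushforward.
(* If coordinate 0 is in [J], the induction hypothesis applies to every section and the constant
   factor leaves the integral. *)
have [J0|J0] := boolP (J ord0).
  have c0 : 0 <= \prod_(i < n | ~~ J' i) P H.
    by apply: prode_ge0 => i _; exact: measure_ge0.
  have mf := measurable_fun_xsection (prod_probability P n) mpre.
  rewrite mul1e /product_measure1 -ge0_integralZr//.
  apply: eq_integral => x _ /=; rewrite tailE -IHn//; last exact: tailJ.
  congr (prod_probability P n _); apply/seteqP; split => s.
    rewrite /xsection/= inE => -[Ms Hs]; split => // i Ji.
    by have := Hs (lift ord0 i); rewrite tnthS; exact.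
  move=> [Ms Hs]; rewrite /xsection/= inE; split => // i.
  by have [j ->|->] := unliftP ord0 i; rewrite ?J0// tnthS; exact: Hs.
(* Otherwise [M] ignores coordinate 0: its sections all equal the one at some [x0], which exists as
   [P] has mass 1, and both events are rectangles. *)
have [x0 _] : [set: T] !=set0.
  apply/set0P; apply/eqP => T0; have := probability_setT P.
  by rewrite T0 measure0 => /eqP; rewrite eq_sym onee_eq0.
have tail0 x : tail x `<=` tail x0.
  move=> s; apply: MJ => i; have [j ->|->] := unliftP ord0 i.
    by rewrite !tnthS.
  by rewrite (negPf J0).
have tail1 x : tail x0 `<=` tail x.
  move=> s; apply: MJ => i; have [j ->|->] := unliftP ord0 i.
    by rewrite !tnthS.
  by rewrite (negPf J0).
rewrite (_ : _ @^-1` M = setT `*` tail x0); last first.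
  by apply/seteqP; split => -[x s] /=; [move/tail0|move=> [_ /(tail1 x)]].
rewrite (_ : _ @^-1` _ = H `*` (tail x0 `&`
    [set s | forall i : 'I_n, ~~ J' i -> H (tnth s i)])); last first.
  apply/seteqP; split => -[x s] /=.
    move=> [/tail0 Ms Hs]; split; first exact: (Hs ord0).
    by split => // i Ji; have := Hs (lift ord0 i); rewrite tnthS; exact.
  move=> [Hx [/(tail1 x) Ms Hs]]; split => // i.
  by have [j ->|->//] := unliftP ord0 i; rewrite tnthS; exact: Hs.
rewrite !product_measure1E//; last first.
  apply: measurableI => //.
  rewrite (_ : [set s | _] = \bigcap_(i in [set i : 'I_n | ~~ J' i])
      ((fun s : n.-tuple T => tnth s i) @^-1` H)); last first.
    by apply/seteqP; split.
  apply: fin_bigcap_measurable => // i _.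
  by rewrite -[X in measurable X]setTI; exact: measurable_tnth.
have /= IH := IHn J' (tail x0) (mtail x0) mH (tailJ x0).
rewrite probability_setT mul1e muleCA. congr (_ * _); exact: IH.
Qed.
End product_probability.

(** * Convex geometry: affine dimension, facets and faces of polyhedra *)

Section polytopes.
Set Implicit Arguments.
Unset Strict Implicit.
Context {R : realType} {d : nat}.
Implicit Types (x y z a p : 'rV[R]_d) (S : set 'rV[R]_d) (v : 'rV[R]_(d + 1)).

Definition cube z (e : R) : set 'rV[R]_d :=
  [set y | forall j, `|y 0 j - z 0 j| < e].

(** Convexity in coordinates, free of the convex-space structure behind [convex_set]. *)
Definition segment_closed S : Prop :=
  forall x y (t : R), S x -> S y -> 0 <= t <= 1 -> S (x + t *: (y - x)).

Lemma dotE a x : dot a x = \sum_j a 0 j * x 0 j.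
Proof. by rewrite /dot mxE; apply: eq_bigr => j _; rewrite mxE. Qed.

Lemma dotDZr a x y (t : R) : dot a (x + t *: y) = dot a x + t * dot a y.
Proof.
rewrite !dotE mulr_sumr -big_split; apply: eq_bigr => j _ /=.
by rewrite !mxE; ring.
Qed.

Lemma dot_segment a x y (t : R) :
  dot a (x + t *: (y - x)) = dot a x + t * (dot a y - dot a x).
Proof.
rewrite dotDZr; congr (_ + _ * _); rewrite !dotE -sumrB.
by apply: eq_bigr => j _; rewrite !mxE mulrBr.
Qed.

Lemma g_segment v x y (t : R) :
  g (x + t *: (y - x)) v = g x v + t * (g y v - g x v).
Proof. by rewrite /g dot_segment; ring. Qed.

Lemma halfspace_segment v : segment_closed (halfspace v).
Proof.
move=> x y t; rewrite /halfspace /= g_segment => gx gy /andP[t0 t1].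
have -> : g x v + t * (g y v - g x v) = (1 - t) * g x v + t * g y v by ring.
by rewrite -oppr_ge0 opprD -!mulrN addr_ge0// mulr_ge0 ?oppr_ge0 ?subr_ge0.
Qed.

Lemma segment_closedI S1 S2 :
  segment_closed S1 -> segment_closed S2 -> segment_closed (S1 `&` S2).
Proof. by move=> h1 h2 x y t [x1 x2] [y1 y2] t01; split; [exact: h1|exact: h2]. Qed.

Lemma interior_cube S : interior S !=set0 -> exists z (e : R), 0 < e /\ cube z e `<=` S.
Proof.
move=> [z]; rewrite /interior => /nbhs_ballP[e /= e0 zeS].
exists z, e; split => // y ye; apply: zeS; split => // i j.
by rewrite (ord1 i) -ball_normE /= distrC.
Qed.

Lemma cube_center z (e : R) : 0 < e -> cube z e z.
Proof. by move=> e0 j; rewrite subrr normr0. Qed.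

(** If the affine function [g] vanished at [z], a small step towards [y] would make it positive
    while still inside the cube. *)
Lemma interior_point_lt0 z (e : R) v y :
  0 < e -> cube z e `<=` halfspace v -> ~ halfspace v y -> g z v < 0.
Proof.
move=> e0 zv yv; rewrite lt_neqAle (zv z (cube_center _ e0)) andbT.
(* [c] exceeds every coordinate of [y - z] in absolute value, so the fraction [e / c] of the way to
   [y] stays in the cube. *)
apply/eqP => gz0; pose c := 1 + \sum_j `|y 0 j - z 0 j|.
have c0 : 0 < c by rewrite ltr_wpDr// sumr_ge0.
have : halfspace v (z + (e / c) *: (y - z)).
  apply: zv => j; rewrite !mxE (_ : _ - _ = (e / c) * (y 0 j - z 0 j)); last by ring.
  rewrite normrM.
  rewrite gtr0_norm ?divr_gt0// -mulrA gtr_pMr// mulrC ltr_pdivrMr// mul1r.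
  by rewrite /c (bigD1 j)//= addrCA ltrDl ltr_wpDr// sumr_ge0.
rewrite /halfspace /= g_segment gz0 subr0 add0r pmulr_rle0 ?divr_gt0//.
Qed.

Lemma affdim_full S z (e : R) : 0 < e -> cube z e `<=` S -> affdim S = d%:Z.
Proof.
move=> e0 zS; rewrite /affdim; set m := (\max_(k < _ | _) _)%N.
suff -> : m = d.+1 by rewrite -addn1 PoszD addrK.
apply/eqP; rewrite eqn_leq; apply/andP; split.
  by apply/bigmax_leqP => k _; rewrite -ltnS.
apply: (@leq_bigmax_cond _ _ _ (@ord_max d.+1)); apply/asboolP.
(* The d + 1 points are [z], at index [ord0], and its translates by [e / 2] along each axis. *)
exists (fun i => z + \row_j (if i == lift ord0 j then e / 2 else 0)); split.
  move=> i; apply: zS => j; rewrite !mxE (addrC (z 0 j)) addrK.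
  by case: ifP => _; rewrite ?normr0// gtr0_norm; lra.
move=> l l0; under eq_bigr do rewrite scalerDr.
rewrite big_split/= -scaler_suml l0 scale0r add0r => /rowP lr.
have ll (j : 'I_d) : l (lift ord0 j) = 0.
  have := lr j; rewrite summxE (bigD1 (lift ord0 j))//= big1.
    rewrite !mxE eqxx addr0 => /eqP; rewrite mulf_eq0 => /orP[/eqP//|].
    by rewrite gt_eqF// divr_gt0.
  by move=> i ij; rewrite !mxE (negPf ij) mulr0.
move=> i; have [j ->|->] := unliftP ord0 i; first exact: ll.
by move: l0; rewrite big_ord_recl big1// addr0.
Qed.

Lemma affdim_hyperplane S a (b : R) p (e : R) : a != 0 -> 0 < e -> dot a p = b ->
  S `<=` [set x | dot a x = b] -> cube p e `&` [set x | dot a x = b] `<=` S ->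
  affdim S = d%:Z - 1.
Proof.
move=> a0 e0 apb SH HS; rewrite /affdim; set m := (\max_(k < _ | _) _)%N.
suff -> : m = d by [].
apply/eqP; rewrite eqn_leq; apply/andP; split.
  apply/bigmax_leqP => k /asboolP[q [qS qind]]; rewrite leqNgt; apply/negP => dk.
  have kE : k = d.+1 :> nat by apply/eqP; rewrite eqn_leq dk andbT -ltnS.
  move: (k : nat) kE q qS qind => {dk k}_ -> q qS qind.
  (* Affine independence of d + 1 points says that this matrix is invertible, but the nonzero vector
     (-b, a) lies in its kernel. *)
  pose M : 'M[R]_(1 + d) := row_mx (const_mx 1) (\matrix_(i, j) q i 0 j).
  have : \det M == 0.
    rewrite -det_tr; apply/det0P; exists (row_mx (const_mx (- b)) a).
      apply: contra a0 => /eqP; rewrite -row_mx0 => /eq_row_mx[_ ->]//.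
    rewrite /M tr_row_mx mul_row_col; apply/rowP => i; rewrite !mxE.
    rewrite big_ord1 !mxE mulr1; apply/eqP; rewrite addrC subr_eq0; apply/eqP.
    rewrite -(SH _ (qS i) : dot a (q i) = b) dotE.
    by apply: eq_bigr => j _; rewrite !mxE.
  move=> /det0P[l l0 /eqP]; rewrite /M mul_mx_row -row_mx0.
  move=> /eqP /eq_row_mx[/rowP l1 /rowP lq].
  case/negP: l0; apply/eqP/rowP => i; rewrite mxE.
  apply: (qind (fun i => l 0 i)).
    have := l1 0; rewrite !mxE => E; rewrite -[RHS]E; apply: eq_bigr => k _.
    by rewrite mxE mulr1.
  apply/rowP => j; have := lq j; rewrite !mxE => E; rewrite -[RHS]E.
  by rewrite summxE; apply: eq_bigr => k _; rewrite !mxE.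
have [j0 aj0] : exists j, a 0 j != 0 by apply/rV0Pn.
have dlt : (d < d.+2)%N by rewrite ltnW.
apply: (@leq_bigmax_cond _ _ _ (Ordinal dlt)); apply/asboolP.
pose c := 1 + \sum_j `|a 0 j|.
have ac j : `|a 0 j| < c.
  by rewrite /c (bigD1 j)//= addrCA ltrDl ltr_wpDr// sumr_ge0.
have c0 : 0 < c by apply: le_lt_trans (ac j0).
(* These are vectors orthogonal to [a]: [w j0] is 0, so that [p] itself is among the d points, and
   the others are linearly independent. *)
pose w (i : 'I_d) : 'rV[R]_d :=
  \row_j ((j == i)%:R * a 0 j0 - (j == j0)%:R * a 0 i).
have aw i : dot a (w i) = 0.
  rewrite dotE; under eq_bigr do rewrite mxE mulrBr.
  rewrite sumrB (bigD1 i)//= big1 => [|j /negPf->]; last by rewrite mul0r mulr0.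
  rewrite (bigD1 j0)//= big1 => [|j /negPf->]; last by rewrite mul0r mulr0.
  by rewrite !eqxx; ring.
(* The entries of each [w i] are below [c + c], so scaling by [r] keeps the points in the cube. *)
pose r := e / (c + c).
have cc0 : 0 < c + c by apply: addr_gt0.
have r0 : 0 < r by rewrite divr_gt0.
exists (fun i => p + r *: w i); split.
  move=> i; apply: HS; split; last first.
    by rewrite /= dotDZr aw mulr0 addr0.
  move=> j; rewrite !mxE (addrC (p 0 j)) addrK normrM gtr0_norm//.
  rewrite /r [ltLHS]mulrAC ltr_pdivrMr// ltr_pM2l//.
  apply: (le_lt_trans (ler_normB _ _)); rewrite !normrM; apply: ltrD.
    by apply: le_lt_trans (ac j0); case: eqP; rewrite ?normr1 ?normr0 ?mul1r ?mul0r.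
  by apply: le_lt_trans (ac i); case: eqP; rewrite ?normr1 ?normr0 ?mul1r ?mul0r.
move=> l l0; under eq_bigr do rewrite scalerDr.
rewrite big_split/= -scaler_suml l0 scale0r add0r => /rowP lr.
have ll j : j != j0 -> l j = 0.
  move=> jj0; have := lr j; rewrite summxE (bigD1 j)//= big1.
    rewrite !mxE eqxx (negPf jj0) addr0 mul1r mul0r subr0.
    clearbody r => /eqP.
    by rewrite !mulf_eq0 (negPf aj0) (gt_eqF r0) !orbF => /eqP.
  by move=> i ij; rewrite !mxE (negPf jj0) eq_sym (negPf ij) !mul0r subr0 !mulr0.
move=> i; have [->|] := eqVneq i j0; last exact: ll.
by move: l0; rewrite (bigD1 j0)//= big1 ?addr0// => j; exact: ll.
Qed.

Definition tight_face S v : set 'rV[R]_d :=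
  S `&` [set x | dot (lsubmx v) x = rsubmx v 0 0].

Lemma tight_face_is_face S v : S `<=` halfspace v -> is_face S (tight_face S v).
Proof.
move=> Sv; exists (lsubmx v), (rsubmx v 0 0); split => // x /Sv.
by rewrite /halfspace /= /g subr_le0.
Qed.

(** By convexity the cube at [z], shrunk towards [y], becomes a cube around the crossing point
    inside [S]; its slice by the hyperplane lies in the face and gives it dimension d - 1. The
    crossing point is kept in order to tell facets apart later. *)
Lemma irredundant_facet S v z (e : R) y :
  segment_closed S -> 0 < e -> cube z e `<=` S `&` halfspace v ->
  S y -> ~ halfspace v y ->
  is_facet (S `&` halfspace v) (tight_face (S `&` halfspace v) v) /\
  exists2 t : R, 0 < t < 1 &
    tight_face (S `&` halfspace v) v (z + t *: (y - z)).
Proof.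
move=> cS e0 zS Sy yv; have zSS : cube z e `<=` S by move=> x /zS[].
have gz : g z v < 0.
  by apply: (interior_point_lt0 e0) yv => x /zS[].
have gy : 0 < g y v by rewrite ltNge; apply/negP.
have gzy : 0 < g y v - g z v by lra.
(* [t] is the root of the affine function [g] along the segment from [z] to [y]. *)
pose t := - g z v / (g y v - g z v).
have t0 : 0 < t by rewrite divr_gt0// oppr_gt0.
have t1 : t < 1 by rewrite ltr_pdivrMr// mul1r; lra.
pose p := z + t *: (y - z).
have gp : g p v = 0 by rewrite g_segment /t; field; rewrite gt_eqF.
have HE x : dot (lsubmx v) x = rsubmx v 0 0 <-> g x v = 0.
  by rewrite /g; split => [->|/eqP]; rewrite ?subrr// subr_eq0 => /eqP.
have near_p : cube p ((1 - t) * e) `&`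
    [set x | dot (lsubmx v) x = rsubmx v 0 0] `<=`
    tight_face (S `&` halfspace v) v.
  move=> x [xp Hx]; split => //; split; last first.
    by rewrite /halfspace /= (HE x).1.
  (* [u] is the preimage of [x] under the homothety with centre [y] and ratio [1 - t], which sends
     [z] to [p]. *)
  pose u := z + (1 - t)^-1 *: (x - p).
  have -> : x = u + t *: (y - u).
    by apply/rowP => j; rewrite /u /p !mxE; field; rewrite subr_eq0 gt_eqF.
  apply: cS => //; last by apply/andP; split; exact: ltW.
  apply: zSS => j; rewrite !mxE (addrC (z 0 j)) addrK normrM.
  rewrite gtr0_norm ?invr_gt0 ?subr_gt0// [ltLHS]mulrC.
  rewrite ltr_pdivrMr ?subr_gt0// [ltRHS]mulrC.
  by have := xp j; rewrite !mxE.
split; last first.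
  exists t; first by rewrite t0.
  apply: near_p; split; last exact/HE.
  by apply: cube_center; rewrite mulr_gt0// subr_gt0.
split; first by apply: tight_face_is_face => x [].
rewrite (affdim_full e0 zS).
apply: (@affdim_hyperplane _ (lsubmx v) (rsubmx v 0 0) p ((1 - t) * e)).
- apply/eqP => a0; move: gzy; rewrite /g a0 !dotE.
  rewrite !big1 => [||j _]; rewrite ?mxE ?mul0r ?subrr ?ltxx// => j _.
  by rewrite mxE mul0r.
- by rewrite mulr_gt0// subr_gt0.
- exact/HE.
- by move=> x [].
- exact: near_p.
Qed.

Definition polyhedron (s : seq 'rV[R]_(d + 1)) : set 'rV[R]_d :=
  [set x | forall v, v \in s -> halfspace v x].

Lemma polyhedron_segment s : segment_closed (polyhedron s).
Proof.
by move=> x y t xs ys t01 v vs; apply: halfspace_segment => //; [exact: xs|exact: ys].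
Qed.

Lemma exists_small_pos (T : eqType) (s : seq T) (Q : T -> R -> Prop) :
  (forall i, i \in s -> exists2 t0, 0 < t0 & forall t, 0 < t <= t0 -> Q i t) ->
  exists2 t, 0 < t & forall i, i \in s -> Q i t.
Proof.
(* The induction carries the claim for all small [t], so that thresholds can be combined by a
   minimum. *)
move=> sQ; suff [t0 t00 H] : exists2 t0, 0 < t0 &
    forall t, 0 < t <= t0 -> forall i, i \in s -> Q i t.
  by exists t0 => // i; apply: H; rewrite t00 lexx.
elim: s sQ => [|i s IHs] sQ; first by exists 1.
have [|t1 t10 H1] := IHs; first by move=> w ws; apply: sQ; rewrite inE ws orbT.
have [t2 t20 H2] := sQ i (mem_head _ _).
exists (Num.min t1 t2); first by rewrite lt_min t10.
move=> t; rewrite le_min => /and3P[t0 tt1 tt2] w; rewrite inE => /orP[/eqP->|ws].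
  by apply: H2; rewrite t0.
by apply: H1; rewrite ?t0.
Qed.

(* T is the set of constraints tight at a point x0 of f where the fewest are
   tight. Midpoints with x0 show that they are tight on all of f; conversely a
   point y where they are tight lies in f since the segment from y to x0 can be
   prolonged beyond x0 inside the polyhedron. *)
Lemma face_tight (s : seq 'rV[R]_(d + 1)) f :
  is_face (polyhedron s) f -> f !=set0 ->
  exists T : {set 'I_(size s)}, f = polyhedron s `&`
    [set x | forall i : 'I_(size s), i \in T -> g x s`_i = 0].
Proof.
move=> [a [b [Sab fE]]] f0.
pose T x := [set i : 'I_(size s) | g x s`_i == 0]%SET.
have : exists n, `[< exists2 x, f x & #|T x| = n >].
  by have [x fx] := f0; exists #|T x|; apply/asboolP; exists x.
move=> /ex_minnP[_ /asboolP[x0 fx0 <-]] Tmin.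
have [Sx0 ax0] : polyhedron s x0 /\ dot a x0 = b by move: fx0; rewrite fE.
have Sg x (i : 'I_(size s)) : polyhedron s x -> g x s`_i <= 0.
  by move=> Sx; apply: Sx; rewrite mem_nth.
exists (T x0); apply/seteqP; split => y.
  move=> fy; have [Sy ay] : polyhedron s y /\ dot a y = b by move: fy; rewrite fE.
  split => // i iT; pose m := x0 + 2^-1 *: (y - x0).
  have fm : f m.
    rewrite fE; split; first by apply: polyhedron_segment => //; lra.
    by rewrite /= dot_segment ax0 ay; ring.
  have gm j : g m s`_j = g x0 s`_j + 2^-1 * (g y s`_j - g x0 s`_j).
    exact: g_segment.
  (* An average of two nonpositive numbers vanishes only if both do; minimality then upgrades the
     inclusion to an equality. *)
  have Tm0 : T m \subset T x0.
    apply/fintype.subsetP => j; rewrite !inE gm => /eqP; have := Sg _ j Sx0.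
    by have := Sg _ j Sy => ? ? ?; apply/eqP; lra.
  have /setP/(_ i) : T m = T x0.
    by apply/eqP; rewrite eqEcard Tm0 Tmin//; apply/asboolP; exists m.
  rewrite iT !inE gm => /eqP; move: iT; rewrite inE => /eqP ->; lra.
move=> [Sy yT]; rewrite fE; split => //=.
have [t t0 St] : exists2 t, 0 < t & forall i : 'I_(size s),
    i \in enum 'I_(size s) -> g (x0 + (- t) *: (y - x0)) s`_i <= 0.
  apply: exists_small_pos => i _; have [gi|gi] := eqVneq (g x0 s`_i) 0.
    by exists 1 => // t _; rewrite g_segment gi yT ?inE ?gi// subrr mulr0 addr0.
  have {}gi : g x0 s`_i < 0 by rewrite lt_neqAle gi Sg.
  have gy := Sg _ i Sy.
  exists (- g x0 s`_i / (- g x0 s`_i - g y s`_i)).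
    by apply: divr_gt0; lra.
  move=> t /andP[t0]; rewrite ler_pdivlMr; last by lra.
  by rewrite g_segment; nra.
have Sw : polyhedron s (x0 + (- t) *: (y - x0)).
  move=> v /(nthP 0)[i ilt <-]; apply: (St (Ordinal ilt)).
  by rewrite mem_enum.
(* The functional equals [b] at [x0] and is at most [b] on both sides of it along the line, so it
   equals [b] at [y]. *)
have := Sab _ Sw; have := Sab _ Sy; rewrite dot_segment ax0 => ayb.
rewrite mulNr gerDl oppr_le0 pmulr_rge0// subr_ge0 => bay.
by apply/eqP; rewrite eq_le ayb.
Qed.

(** A nonempty face is determined by its set of tight constraints. Finiteness is what makes
    [fset_set] in [num_facets] count the facets. *)
Lemma finite_faces (s : seq 'rV[R]_(d + 1)) :
  finite_set [set f | is_face (polyhedron s) f].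
Proof.
pose F (T : {set 'I_(size s)}) := polyhedron s `&`
  [set x | forall i : 'I_(size s), i \in T -> g x s`_i = 0].
apply: (@sub_finite_set _ _ ([set set0] `|` range F)).
  move=> f /= ff; have [f0|] := pselect (f !=set0); last first.
    by move=> /set0P/negP/negPn/eqP; left.
  by right; have [T ->] := face_tight ff f0; exists T.
by rewrite finite_setU; split; [exact: finite_set1|exact: finite_image].
Qed.

End polytopes.

(** * Support subsamples and the number of facets *)

Section scenario.
Set Implicit Arguments.
Unset Strict Implicit.
Context {R : realType} {d : nat}.
Context {disp : measure_display} {Delta : measurableType disp}.
Context (vec : Delta -> 'rV[R]_(d + 1)).
Implicit Types (X S : set 'rV[R]_d).

(** The feasible set of [subsample s I], indexed by the original samples to avoid tuples of length
    [#|I|]. *)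
Definition relaxed_set X N (s : N.-tuple Delta) (I : {set 'I_N}) :
    set 'rV[R]_d :=
  [set x | forall i, i \in I -> halfspace (vec (tnth s i)) x] `&` X.

Lemma feasible_subsample X N (s : N.-tuple Delta) (I : {set 'I_N}) :
  feasible_set vec X (subsample s I) = relaxed_set X s I.
Proof.
apply/seteqP; split => x [xs Xx]; split => // i.
  move=> iI; have := xs (enum_rank_in iI i) Logic.I.
  by rewrite tnth_mktuple enum_rankK_in.
by move=> _; rewrite tnth_mktuple; apply: xs; exact: enum_valP.
Qed.

Lemma relaxed_setD1 X N (s : N.-tuple Delta) (I : {set 'I_N}) i : i \in I ->
  relaxed_set X s I =
  relaxed_set X s (I :\ i)%SET `&` halfspace (vec (tnth s i)).
Proof.
move=> iI; apply/seteqP; split => x.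
  move=> [xI Xx]; split; last exact: xI.
  by split => // j /setD1P[_]; exact: xI.
move=> [[xI Xx] xi]; split => // j jI.
by have [->//|ji] := eqVneq j i; apply: xI; apply/setD1P.
Qed.

Lemma feasible_relaxed X N (s : N.-tuple Delta) (I : {set 'I_N}) :
  feasible_set vec X s `<=` relaxed_set X s I.
Proof. by move=> x [xs Xx]; split => // i _; exact: xs. Qed.

Lemma feasible_polyhedron (c : seq 'rV[R]_(d + 1)) N (s : N.-tuple Delta) :
  feasible_set vec (polyhedron c) s =
  polyhedron ([seq vec (tnth s i) | i <- enum 'I_N] ++ c).
Proof.
apply/seteqP; split => x.
  move=> [xs xc] v; rewrite mem_cat => /orP[/mapP[i _ ->]|]; last exact: xc.
  exact: xs.
move=> xsc; split => [i _|v vc]; apply: xsc; rewrite mem_cat ?vc ?orbT//.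
by apply/orP; left; apply/mapP; exists i; rewrite ?mem_enum.
Qed.

Lemma irreducible_card_le_facets (c : seq 'rV[R]_(d + 1)) N
    (s : N.-tuple Delta) (I : {set 'I_N}) (X := polyhedron c) :
  interior (feasible_set vec X s) !=set0 ->
  relaxed_set X s I = feasible_set vec X s ->
  (forall i, i \in I -> relaxed_set X s (I :\ i)%SET <> feasible_set vec X s) ->
  (#|I| <= num_facets (feasible_set vec X s))%N.
Proof.
move=> /interior_cube[z [e [e0 zS]]] IE Iirr.
set S := feasible_set vec X s in zS IE Iirr *.
pose v i := vec (tnth s i).
have y_ i : i \in I -> exists2 y, relaxed_set X s (I :\ i)%SET y & ~ halfspace (v i) y.
  move=> iI; apply: contrapT => noy; apply: (Iirr i iI).
  rewrite -IE (relaxed_setD1 X s iI); apply/seteqP; split => [x xr|x []//].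
  by split => //; apply: contrapT => xv; apply: noy; exists x.
have segI i : segment_closed (relaxed_set X s (I :\ i)%SET).
  move=> x y t [xs Xx] [ys Xy] t01; split; last exact: polyhedron_segment.
  by move=> j jI; apply: halfspace_segment => //; [exact: xs|exact: ys].
have facetP i : i \in I -> is_facet S (tight_face S (v i)) /\
    forall j, j \in I -> tight_face S (v i) = tight_face S (v j) -> i = j.
  move=> iI; have [y yr yv] := y_ i iI.
  have SE : S = relaxed_set X s (I :\ i)%SET `&` halfspace (v i).
    by rewrite -IE (relaxed_setD1 X s iI).
  move: (zS); rewrite {1}SE => zSi.
  have [] := irredundant_facet (segI i) e0 zSi yr yv.
  rewrite -SE => fS [t /andP[t0 t1] pf]; split => // j jI fE.
  (* If [i] and [j] shared a facet, constraint [j] would be tight at the crossing point of [i]; but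
     there [g] averages a negative value at [z] and a nonpositive one at [y]. *)
  apply/eqP/negPn/negP => ij; move: pf; rewrite fE => -[_ /= /eqP].
  rewrite -subr_eq0 -/(g _ _) g_segment => /eqP gp.
  have gz : g z (v j) < 0.
    have [y' _ yv'] := y_ j jI; apply: (interior_point_lt0 e0) yv'.
    by move=> x /zS[+ _]; exact.
  have gy : g y (v j) <= 0.
    by case: yr => yr _; apply: yr; rewrite !inE eq_sym ij.
  have : (1 - t) * g z (v j) + t * g y (v j) < 0.
    rewrite ltr_wnDr// ?mulr_ge0_le0 ?pmulr_rlt0 ?subr_gt0//; exact: ltW.
  lra.
rewrite /num_facets cardE -(size_map (fun i => tight_face S (v i))).
apply: uniq_leq_size.
  rewrite map_inj_in_uniq ?enum_uniq// => i j; rewrite !mem_enum => iI jI.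
  exact: (facetP i iI).2.
move=> _ /mapP[i + ->]; rewrite mem_enum => iI.
rewrite in_fset_set ?inE; last first.
  rewrite /S /X feasible_polyhedron.
  by apply: sub_finite_set (@finite_faces _ _ _) => f [ff _]; exact: ff.
exact: (facetP i iI).1.
Qed.

End scenario.

(** * Violation at rational points and the bound for a fixed set of samples *)

Section violation.
Set Implicit Arguments.
Unset Strict Implicit.
Context {R : realType} {d : nat}.
Context {disp : measure_display} {Delta : measurableType disp}.
Context (vec : Delta -> 'rV[R]_(d + 1)) (P : probability Delta R).
Context (violation_measurable : forall x : 'rV[R]_d,
  measurable [set delta : Delta | ~ halfspace (vec delta) x]).
Implicit Types (X S : set 'rV[R]_d).

(** A countable dense set, so that the search for a violating point becomes a countable union of
    events. *)
Definition rat_point (q : 'rV[rat]_d) : 'rV[R]_d := map_mx ratr q.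

Lemma rat_point_cube (w : 'rV[R]_d) (r : R) : 0 < r ->
  exists q, cube w r (rat_point q).
Proof.
move=> r0; have q_ (j : 'I_d) : {q : rat | `|ratr q - w 0 j| < r}.
  apply: cid; have [|q] := @rat_in_itvoo R (w 0 j - r) (w 0 j + r); first lra.
  by rewrite in_itv/= => /andP[q1 q2]; exists q; rewrite ltr_norml; lra.
exists (\row_j sval (q_ j)) => j; rewrite !mxE; exact: svalP (q_ j).
Qed.

(** In the sup norm [g] is Lipschitz in the point, with constant [A] the sum of the absolute values
    of the normal's entries. *)
Lemma g_eventually_gt0 (x : 'rV[R]_d) (q : nat -> 'rV[R]_d) (C : R) v :
  0 <= C -> (forall n j, `|q n 0 j - x 0 j| <= C / n.+1%:R) -> 0 < g x v ->
  exists n, forall m, (n <= m)%N -> 0 < g (q m) v.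
Proof.
move=> C0 qx gx; pose A := \sum_j `|lsubmx v 0 j|.
have A0 : 0 <= A by rewrite sumr_ge0.
exists (Num.Def.archi_bound (A * C / g x v)) => m nm.
have gq : g x v - g (q m) v <= A * (C / m.+1%:R).
  rewrite /g opprB addrA subrK !dotE -sumrB mulr_suml; apply: ler_sum => j _.
  rewrite -mulrBr (le_trans (ler_norm _))// normrM ler_wpM2l// distrC.
  exact: qx.
suff H : A * (C / m.+1%:R) < g x v by have := le_lt_trans gq H; lra.
rewrite mulrA ltr_pdivrMr// [ltRHS]mulrC -ltr_pdivrMr//.
apply: (lt_le_trans (archi_boundP _)); first by rewrite divr_ge0 ?mulr_ge0// ltW.
by rewrite ler_nat ltnW.
Qed.

(* Fatou: the violation probability is lower semicontinuous, so it stays above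
   c at a rational point reached from x through the interior of S. *)
Lemma violation_rat_point S z (e : R) x (c : R) :
  segment_closed S -> 0 < e -> cube z e `<=` S -> S x ->
  (c%:E < violation vec P x)%E ->
  exists q, S (rat_point q) /\ (c%:E < violation vec P (rat_point q))%E.
Proof.
move=> cS e0 zS Sx cx; pose t n : R := n.+1%:R^-1.
have t0 n : 0 < t n by rewrite invr_gt0.
have t1 n : t n <= 1 by rewrite invf_le1// ler1n.
have q_ n : {q | cube (x + t n *: (z - x)) (t n * e) (rat_point q)}.
  by apply: cid; apply: rat_point_cube; rewrite mulr_gt0.
pose q n := sval (q_ n).
have qP n : cube (x + t n *: (z - x)) (t n * e) (rat_point (q n)).
  exact: svalP (q_ n).
have Sq n : S (rat_point (q n)).
  (* The rational point lies on the segment from [x] to [u], and [u] is in the cube at [z]. *)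
  pose u := z + (t n)^-1 *: (rat_point (q n) - (x + t n *: (z - x))).
  have tn0 : t n != 0 by rewrite gt_eqF.
  have -> : rat_point (q n) = x + t n *: (u - x).
    by apply/rowP => j; rewrite /u; move: (rat_point _) => y;
      rewrite !mxE; field.
  apply: cS => //; last by rewrite ltW//= t1.
  apply: zS => j; rewrite !mxE (addrC (z 0 j)) addrK normrM gtr0_norm ?invr_gt0//.
  rewrite [ltLHS]mulrC ltr_pdivrMr// [ltRHS]mulrC.
  by have := qP n j; rewrite !mxE.
pose C := e + \sum_j `|z 0 j - x 0 j|.
have C0 : 0 <= C by rewrite addr_ge0 ?sumr_ge0// ltW.
have qC n j : `|rat_point (q n) 0 j - x 0 j| <= C / n.+1%:R.
  have zC : `|z 0 j - x 0 j| <= \sum_j `|z 0 j - x 0 j|.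
    by rewrite (bigD1 j)//= lerDl sumr_ge0.
  rewrite -/(t n); have := qP n j; move: (rat_point _) => y; rewrite !mxE => yx.
  have -> : y 0 j - x 0 j =
      (y 0 j - (x 0 j + t n * (z 0 j - x 0 j))) + t n * (z 0 j - x 0 j) by ring.
  rewrite (le_trans (ler_normD _ _))// /C mulrDl lerD//.
    by rewrite [leRHS]mulrC ltW.
  by rewrite normrM gtr0_norm// [leLHS]mulrC ler_pM2r.
pose U m := [set delta : Delta | ~ halfspace (vec delta) (rat_point (q m))].
(* The union of the [F n] is the lower limit of the events [U m]; it contains every sample violated
   at [x]. *)
pose F n := \bigcap_(m in [set m | (n <= m)%N]) U m.
have mF n : measurable (F n).
  apply: bigcap_measurable => [|m _]; last exact: violation_measurable.
  by exists n => /=.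
have mUF : measurable (\bigcup_n F n) by exact: bigcupT_measurable.
have ndF : {homo F : n m / (n <= m)%N >-> (n <= m)%O}.
  move=> n m nm; apply/subsetPset => D FD k /= mk; apply: FD.
  exact: leq_trans nm mk.
have cF : (c%:E < P (\bigcup_n F n))%E.
  apply: (lt_le_trans cx); rewrite /violation le_measure ?inE//.
  move=> D /=; rewrite /halfspace/= => /negP; rewrite -ltNge => gD.
  have [n nD] := g_eventually_gt0 C0 qC gD.
  by exists n => // m /nD gq; apply/negP; rewrite -ltNge.
have [n cFn] : exists n, (c%:E < P (F n))%E.
  apply: contrapT => nF; move: cF; rewrite ltNge => /negP; apply.
  have PF := nondecreasing_cvg_mu (mu := P) mF mUF ndF.
  rewrite -(cvg_lim _ PF)//; apply: lime_le; first by apply/cvg_ex; eexists; exact: PF.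
  by apply: nearW => n; rewrite leNgt; apply/negP => cFn; apply: nF; exists n.
exists (q n); split => //; apply: (lt_le_trans cFn).
by rewrite /violation le_measure ?inE// => D; apply => /=.
Qed.

Lemma measurable_halfspace x :
  measurable [set delta : Delta | halfspace (vec delta) x].
Proof.
rewrite (_ : [set _ | _] = ~` [set delta | ~ halfspace (vec delta) x]).
  exact: measurableC.
by apply/seteqP; split => D /=; [move=> xD; apply|exact: contrapT].
Qed.

Lemma halfspace_probability_le x (c : R) :
  (c%:E <= violation vec P x)%E ->
  (P [set delta | halfspace (vec delta) x] <= (1 - c)%:E)%E.
Proof.
move=> cx; rewrite (_ : [set _ | _] = ~` [set delta | ~ halfspace (vec delta) x]).
  by rewrite probability_setC// EFinB leeB.
by apply/seteqP; split => D /=; [move=> xD; apply|exact: contrapT].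
Qed.

Lemma prode_notin_le n (J : {set 'I_n}) (p : \bar R) (r : R) :
  (0 <= p)%E -> (p <= r%:E)%E ->
  (\prod_(i < n | i \notin J) p <= (r ^+ (n - #|J|))%:E)%E.
Proof.
case: p => [p| |]; rewrite ?leye_eq// => p0 pr.
rewrite prodEFin lee_fin prodr_const (_ : #|_| = n - #|J|)%N.
  by apply: lerXn2r; rewrite ?nnegrE -?lee_fin//; exact: le_trans pr.
transitivity (#|J| + #|~: J|%SET - #|J|)%N; last by rewrite cardsC card_ord.
by rewrite addKn; apply: eq_card => i; rewrite !inE.
Qed.

Lemma measurable_tnth_all n (J : {set 'I_n}) (H : 'I_n -> set Delta) :
  (forall i, measurable (H i)) ->
  measurable [set s : n.-tuple Delta | forall i, i \in J -> H i (tnth s i)].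
Proof.
move=> mH; rewrite (_ : [set _ | _] = \bigcap_(i in [set i | i \in J])
    ((fun s : n.-tuple Delta => tnth s i) @^-1` H i)); last first.
  by apply/seteqP; split.
apply: fin_bigcap_measurable => // i _.
by rewrite -[X in measurable X]setTI; exact: measurable_tnth.
Qed.

(* The rational points are enumerated: D n collects the samples for which the
   n-th one is the first that violates more than c and satisfies the
   constraints in J, an event depending only on the coordinates in J. *)
Lemma support_violation_le N (X : set 'rV[R]_d) (J : {set 'I_N}) (c : R) :
  segment_closed X -> c <= 1 ->
  (forall s : N.-tuple Delta, interior (feasible_set vec X s) !=set0) ->
  exists W : set (N.-tuple Delta), [/\ measurable W,
    [set s | relaxed_set vec X s J = feasible_set vec X s /\
       (c%:E < set_violation vec P (feasible_set vec X s))%E] `<=` W &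
    (prod_probability P N W <= ((1 - c) ^+ (N - #|J|))%:E)%E].
Proof.
move=> cX c1 intX.
(* Numbers coding no rational vector give the point 0; repetitions are harmless as only first
   indices count. *)
pose q (n : nat) : 'rV[R]_d := rat_point (odflt 0 (unpickle n)).
pose H n := [set delta | halfspace (vec delta) (q n)].
pose good n := X (q n) /\ (c%:E < violation vec P (q n))%E.
pose G n := [set s : N.-tuple Delta |
  good n /\ forall i, i \in J -> H n (tnth s i)].
pose rest n := [set s : N.-tuple Delta |
  forall i, i \notin J -> H n (tnth s i)].
have mH n : measurable (H n) by exact: measurable_halfspace.
have mG n : measurable (G n).
  have [gn|gn] := pselect (good n); last first.
    rewrite (_ : G n = set0); first exact: measurable0.
    by apply/seteqP; split => s // [].
  rewrite (_ : G n = [set s | forall i, i \in J -> H n (tnth s i)]).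
    exact: (measurable_tnth_all _ (fun=> mH n)).
  by apply/seteqP; split => s; [case|].
have mD n : measurable (seqDU G n) by exact: seqDU_measurable.
have mrest n : measurable (rest n).
  rewrite (_ : rest n = [set s | forall i, i \in (~: J)%SET -> H n (tnth s i)]).
    exact: (measurable_tnth_all _ (fun=> mH n)).
  by apply/seteqP; split => s sJ i; have := sJ i; rewrite inE.
have mW n : measurable (seqDU G n `&` rest n) by exact: measurableI.
have mUW : measurable (\bigcup_n (seqDU G n `&` rest n)).
  exact: bigcupT_measurable.
exists (\bigcup_n (seqDU G n `&` rest n)); split => //.
- move=> s /= [sJ /ereal_sup_gt[_ [x xs <-] cx]].
  have [z [e [e0 zs]]] := interior_cube (intX s).
  have cs : segment_closed (feasible_set vec X s).
    rewrite -sJ; apply: segment_closedI => // x1 x2 t h1 h2 t01 i iJ.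
    by apply: halfspace_segment => //; [exact: h1|exact: h2].
  have [r [rs cr]] := violation_rat_point cs e0 zs xs cx.
  have : (\bigcup_n G n) s.
    exists (pickle r) => //; rewrite /G /good /H /q /= pickleK /=.
    by case: rs => rs Xr; split => // i _; exact: rs.
  (* The first index [n] may differ from [pickle r], but its point satisfies the constraints in [J],
     hence all of them by [sJ]. *)
  rewrite seqDU_bigcup_eq => -[n _ Dn]; exists n => //; split => // i _.
  have [[Xq _] qJ] : G n s by case: Dn.
  have : relaxed_set vec X s J (q n) by [].
  by rewrite sJ => -[+ _]; exact.
have c'0 : 0 <= (1 - c) ^+ (N - #|J|) by rewrite exprn_ge0// subr_ge0.
apply: (le_trans (generalized_Boole_inequality (prod_probability P N) mW mUW)).
(* Independence extracts the same factor from each term; the sets [seqDU G n] are disjoint, so their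
   probabilities add up to at most 1. *)
apply: (@le_trans _ _ (\sum_(0 <= n <oo)
    (((1 - c) ^+ (N - #|J|))%:E * prod_probability P N (seqDU G n)))%E).
  apply: lee_nneseries => [n _ _|n _]; first exact: measure_ge0.
  have [[_ cn]|gn] := pselect (good n); last first.
    rewrite (_ : seqDU G n = set0); last by apply/seteqP; split => s // [[/gn]].
    by rewrite set0I !measure0 mule0.
  have GJ (s t : N.-tuple Delta) k :
      (forall i, i \in J -> tnth s i = tnth t i) -> G k s -> G k t.
    by move=> st [gk sk]; split => // i iJ; rewrite -st//; exact: sk.
  have DJ (s t : N.-tuple Delta) :
      (forall i, i \in J -> tnth s i = tnth t i) ->
      seqDU G n s -> seqDU G n t.
    move=> st [Gs nGs]; split; first exact: GJ Gs.
    move=> Gt; apply: nGs; move: Gt; rewrite -!bigcup_mkord => -[k kn Gk].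
    exists k; first exact: kn.
    by apply: (GJ _ _ _ _ Gk) => i iJ; rewrite st.
  have indep := @prod_probability_indep _ _ _ P N (fun i => i \in J) _ _
    (mD n) (mH n) DJ.
  rewrite [leLHS](_ : _ =
    prod_probability P N (seqDU G n) * \prod_(i < N | i \notin J) P (H n))%E;
    last exact: indep.
  rewrite muleC lee_wpmul2r//.
  by apply: prode_notin_le => //; apply: halfspace_probability_le; exact: ltW.
rewrite nneseriesZl//.
have mUD : measurable (\bigcup_n seqDU G n) by exact: bigcupT_measurable.
rewrite -measure_semi_bigcup//.
by rewrite -[leRHS]mule1 lee_wpmul2l// probability_le1.
Qed.

End violation.

(** * The union bound over sets of samples *)

Theorem theorem6 (R : realType) (d : nat)
  (disp : measure_display) (Delta : measurableType disp)
  (P : probability Delta R)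
  (* the elements of Delta are vectors (a^T b) of R^(d+1) *)
  (vec : Delta -> 'rV[R]_(d + 1)) (vec_inj : injective vec)
  (* V(x) is defined for every x *)
  (violation_measurable : forall x : 'rV[R]_d,
     measurable [set delta : Delta | ~ halfspace (vec delta) x])
  (N : nat)
  (X : set 'rV[R]_d) (X_polytope : is_polytope X)
  (feasible_interior : forall s : N.-tuple Delta,
     interior (feasible_set vec X s) !=set0)
  (A : forall n, n.-tuple Delta -> set 'rV[R]_d)
  (A_algorithm : is_algorithm vec X N A)
  (B : N.-tuple Delta -> {set 'I_N})
  (B_support : support_subsample_function A B)
  (beta : R) (beta_gt0 : 0 < beta) (beta_lt1 : beta < 1)
  (* eps is only used on {0, ..., N} *)
  (eps : nat -> R)
  (eps_ge0 : forall k, (k <= N)%N -> 0 <= eps k)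
  (eps_le1 : forall k, (k <= N)%N -> eps k <= 1)
  (eps_N : eps N = 1)
  (eps_sum :
     \sum_(k < N) ('C(N, k))%:R * (1 - eps k) ^+ (N - k) = beta) :
  (prod_probability P N
     [set s : N.-tuple Delta |
       ((eps (minn (num_facets (feasible_set vec X s)) N))%:E
          < set_violation vec P (feasible_set vec X s))%E]
   <= beta%:E)%E.
Proof.
have [c XE] : exists c, X = polyhedron c.
  by have [_ _ _ [c ->]] := X_polytope; exists c.
have AE n (s : n.-tuple Delta) : (n <= N)%N -> A n s = feasible_set vec X s.
  by move=> /(A_algorithm n s)[].
have cardN (I : {set 'I_N}) : (#|I| <= N)%N.
  by rewrite -[leqRHS]card_ord max_card.
have supp s (I : {set 'I_N}) :
    support_subsample A s I <-> relaxed_set vec X s I = feasible_set vec X s.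
  by rewrite /support_subsample !AE// feasible_subsample.
have cX : segment_closed X by rewrite XE; exact: polyhedron_segment.
(* Measurable covers of the events for [k] and [J], to which subadditivity applies; [set0] is a
   dummy value for [k] at least [N]. *)
have W_ (k : nat) (J : {set 'I_N}) : exists W : set (N.-tuple Delta),
    (k < N)%N -> [/\ measurable W,
    [set s | relaxed_set vec X s J = feasible_set vec X s /\
       ((eps k)%:E < set_violation vec P (feasible_set vec X s))%E] `<=` W &
    (prod_probability P N W <= ((1 - eps k) ^+ (N - #|J|))%:E)%E].
  have [kN|] := ltnP k N; last by exists set0.
  have [W WP] := @support_violation_le _ _ _ _ vec P violation_measurable N X J
    (eps k) cX (eps_le1 _ (ltnW kN)) feasible_interior.
  by exists W.
have {W_}[W WP] : exists W : nat -> {set 'I_N} -> set (N.-tuple Delta),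
    forall k J, (k < N)%N -> [/\ measurable (W k J),
    [set s | relaxed_set vec X s J = feasible_set vec X s /\
       ((eps k)%:E < set_violation vec P (feasible_set vec X s))%E] `<=` W k J &
    (prod_probability P N (W k J) <= ((1 - eps k) ^+ (N - #|J|))%:E)%E].
  exists (fun k J => sval (cid (W_ k J))) => k J.
  exact: svalP (cid (W_ k J)).
pose U (k : 'I_N) := \big[setU/set0]_(J : {set 'I_N} | #|J| == k) W k J.
have mW (k : 'I_N) (J : {set 'I_N}) : #|J| == k -> measurable (W k J).
  by move=> _; have [] := WP k J (ltn_ord k).
have bad_sub : [set s : N.-tuple Delta |
    ((eps (minn (num_facets (feasible_set vec X s)) N))%:E
       < set_violation vec P (feasible_set vec X s))%E] `<=`
    \big[setU/set0]_(k < N) U k.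
  move=> s /=; set S := feasible_set vec X s; set k := minn _ N => ks.
  (* The level at [N] is 1, which no violation probability exceeds. *)
  have kN : (k < N)%N.
    rewrite ltn_neqAle geq_minr andbT; apply/negP => /eqP kN.
    move: ks; rewrite kN eps_N ltNge => /negP; apply.
    by apply: ge_ereal_sup => _ [x _ <-]; exact: probability_le1.
  have [/supp BE Birr] := B_support s.
  have Bk : (#|B s| <= k)%N.
    rewrite leq_min cardN andbT; rewrite /S XE.
    apply: irreducible_card_le_facets; rewrite -XE//.
    by move=> i iB /supp; exact: Birr.
  (* With exactly k elements in J, the exponent N - |J| matches the level
     eps k. *)
  have [J BJ Jk] : exists2 J : {set 'I_N}, B s \subset J & #|J| = k.
    by apply: exists_superset; rewrite // card_ord ltnW.
  have JE : relaxed_set vec X s J = S.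
    apply/seteqP; split; last exact: feasible_relaxed.
    rewrite /S -BE => x [xJ Xx]; split => // i iB; apply: xJ.
    exact: (fintype.subsetP BJ).
  rewrite (bigD1 (Ordinal kN))//=; left; rewrite /U (bigD1 J) ?Jk//=; left.
  by have [_ + _] := WP k J kN; apply.
apply: (le_trans (prod_probability_mono P bad_sub)).
have mU (k : 'I_N) : true -> measurable (U k).
  by move=> _; exact: (measure_bigsetU_le (prod_probability P N) _ (mW k)).1.
apply: (le_trans (measure_bigsetU_le (prod_probability P N) _ mU).2).
rewrite -eps_sum -sumEFin; apply: lee_sum => k _.
apply: (le_trans (measure_bigsetU_le (prod_probability P N) _ (mW k)).2).
apply: (@le_trans _ _ (\sum_(J : {set 'I_N} | #|J| == k)
    ((1 - eps k) ^+ (N - k))%:E)%E).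
  apply: lee_sum => J /eqP Jk; rewrite -Jk.
  by have [_ _] := WP k J (ltn_ord k); rewrite Jk.
(* Counting the sets [J] of each size produces the binomial coefficients of [eps_sum]. *)
have draws (j : nat) : #|[pred J : {set 'I_N} | #|J| == j]| = 'C(N, j).
  by have := card_draws 'I_N j; rewrite card_ord cardsE.
by rewrite sumEFin lee_fin sumr_const mulr_natl draws.
Qed.
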